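(* Let $X\subset\mathbb{CP}^N$ be a projective algebraic surface of degree $8$ admitting a projective degeneration into a union of $8$ planes whose shadow is the complex $X^2$ described in the context, and let $X_{\mathrm{Gal}}$ be the Galois cover of $X$ with respect to a generic projection $X\to\mathbb{CP}^2$. Then the fundamental group $\pi_1(X_{\mathrm{Gal}})$ is trivial.
   Context: **Degeneration and shadow.** A generic projection $p':X_0\to\mathbb{CP}^2$ is a projective degeneration of a generic projection $p:Y\to\mathbb{CP}^2$ if there are a flat family $\pi:V\to\Delta$ over the unit disc and a map $F:V\to\Delta\times\mathbb{CP}^2$ (called an embedding in the source) whose composition with the first projection is $\pi$, such that $\pi^{-1}(0)\simeq X_0$, $\pi^{-1}(t_0)\simeq Y$ for some $t_0\neq0$, the family is smooth over $\Delta\setminus\{0\}$, and $F$ restricts to $0\times p'$ on $\pi^{-1}(0)$ and to $t_0\times p$ on $\pi^{-1}(t_0)$. Here the degenerate fibre is a union of planes ($\cong\mathbb{CP}^2$), with only two planes meeting along any line. The shadow of the degeneration is the 2-dimensional complex with one triangle for each plane; two triangles share an edge (resp. a vertex) if the corresponding planes meet in a line (resp. a point). An edge belonging to a single triangle is redundant; only non-redundant edges are numbered $1,\dots,q$. The multiplicity of a vertex is the number of non-redundant edges at it. **Shadow $X^2$.** Vertices $V_1,\dots,V_7$; triangles $V_1V_6V_4$, $V_1V_4V_2$, $V_1V_2V_5$, $V_1V_5V_6$, $V_3V_4V_2$, $V_3V_4V_7$, $V_3V_7V_5$, $V_3V_5V_2$. The $q=10$ non-redundant edges are $1=V_1V_6$,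 $2=V_1V_4$, $3=V_1V_5$, $4=V_1V_2$, $5=V_2V_4$, $6=V_2V_5$, $7=V_2V_3$, $8=V_3V_4$, $9=V_3V_5$, $10=V_3V_7$. **Galois cover.** For a generic projection $f:X\to\mathbb{CP}^2$ of degree $n$ (here $n=8$), $X_{\mathrm{Gal}}=\overline{(X\times_{\mathbb{CP}^2}\cdots\times_{\mathbb{CP}^2}X)\setminus\triangle}$ ($n$ factors), where $\triangle$ is the extended diagonal $\{(x_1,\dots,x_n): x_i=x_j \text{ for some } i\ne j\}$. Let $S\subset\mathbb{CP}^2$ be the branch curve of $f$ and $G=\pi_1(\mathbb{CP}^2\setminus S)$. The group $G$ is generated by $\gamma_i,\gamma_{i'}$ ($1\le i\le q$). There is an exact sequence $$1\to\pi_1(X_{\mathrm{Gal}})\to G/\langle\langle\gamma^2\rangle\rangle\to S_n\to1,$$ where $\langle\langle\gamma^2\rangle\rangle$ is the normal subgroup generated by all $\gamma_i^2,\gamma_{i'}^2$, and $\gamma_i,\gamma_{i'}$ both map to the transposition exchanging the two triangles that share edge $i$. **Presentation of $G$ (the standard Van Kampen presentation from the regeneration technique).** Write $[x,y]=xyx^{-1}y^{-1}$ and $\langle x,y\rangle=xyxy^{-1}x^{-1}y^{-1}$. The group $G$ is presented on the generators above with the following relations. (R4) For each $(i,j,k,l)\in\{(1,2,3,4),(4,5,6,7),(7,8,9,10)\}$, writing $a,a',b,b',c,c',d,d'$ for $\gamma_i,\gamma_{i'},\gamma_j,\gamma_{j'},\gamma_k,\gamma_{k'},\gamma_l,\gamma_{l'}$: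 - $\langle a',b\rangle=\langle a',b'\rangle=\langle a',b^{-1}b'b\rangle=e$; - $\langle c,d\rangle=\langle c',d\rangle=\langle c^{-1}c'c,d\rangle=e$; - $[b'ba'b^{-1}b'^{-1},d]=e$; - $[b'ba'b^{-1}b'^{-1},c^{-1}c'^{-1}d^{-1}d'dc'c]=e$; - $\langle a,b\rangle=\langle a,b'\rangle=\langle a,b^{-1}b'b\rangle=e$; - $\langle c,d^{-1}d'd\rangle=\langle c',d^{-1}d'd\rangle=\langle c^{-1}c'c,d^{-1}d'd\rangle=e$; - $[b'bab^{-1}b'^{-1},d^{-1}d'd]=e$; - $[b'bab^{-1}b'^{-1},c^{-1}c'^{-1}d^{-1}d'^{-1}dd'dc'c]=e$; - $b'ba'ba'^{-1}b^{-1}b'^{-1}=dc'd^{-1}$; - $b'ba'b'a'^{-1}b^{-1}b'^{-1}=dc'cc'^{-1}d^{-1}$; - $b'baba^{-1}b^{-1}b'^{-1}=d^{-1}d'dc'd^{-1}d'^{-1}d$; - $b'bab'a^{-1}b^{-1}b'^{-1}=d^{-1}d'dc'cc'^{-1}d^{-1}d'^{-1}d$. (R3) For each $(i,j,k)\in\{(2,5,8),(3,6,9)\}$, writing $a,a',b,b',c,c'$ for $\gamma_i,\gamma_{i'},\gamma_j,\gamma_{j'},\gamma_k,\gamma_{k'}$: - $\langle a',b\rangle=\langle a',b'\rangle=\langle a',b^{-1}b'b\rangle=e$; - $a=b'ba'b^{-1}b'^{-1}$; - $\langle c,b'ba'ba'^{-1}b^{-1}b'^{-1}\rangle=\langle c,b'ba'b'a'^{-1}b^{-1}b'^{-1}\rangle=\langle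 c,b'ba'b^{-1}b'ba'^{-1}b^{-1}b'^{-1}\rangle=e$; - $c'=c\,b'ba'b'ba'^{-1}b^{-1}b'^{-1}\,c\,b'ba'b^{-1}b'^{-1}a'^{-1}b^{-1}b'^{-1}\,c^{-1}$; - $[a,c]=[a,c']=[a',c]=[a',c']=e$. (R1) $\gamma_i=\gamma_{i'}$ for $i=1,10$. (R5) $[x,y]=e$ for all $x\in\{\gamma_i,\gamma_{i'}\}$, $y\in\{\gamma_j,\gamma_{j'}\}$, whenever edges $i,j$ have no common vertex, i.e. $(i,j)\in(\{1\}\times\{5,6,7,8,9,10\})\cup(\{2\}\times\{6,7,9,10\})\cup(\{3\}\times\{5,7,8,10\})\cup(\{4\}\times\{8,9,10\})\cup(\{5\}\times\{9,10\})\cup(\{6\}\times\{8,10\})$. (RP) $\gamma_{10'}\gamma_{10}\gamma_{9'}\gamma_9\cdots\gamma_{1'}\gamma_1=e$. *)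

(* Defs.v *)
From HB Require Import structures.
From mathcomp Require Import all_boot all_order all_algebra all_fingroup.
From mathcomp Require Import generic_quotient complex lra.
From mathcomp.multinomials Require Import -(notations) mpoly.
From mathcomp Require Import all_classical all_reals all_analysis.

Set Implicit Arguments.
Unset Strict Implicit.
Unset Printing Implicit Defensive.

Import Order.TTheory GRing.Theory Num.Theory.
Import numFieldNormedType.Exports.

Local Open Scope classical_set_scope.
Local Open Scope quotient_scope.
Local Open Scope ring_scope.

Section Loops.
Context {R : realType} {T : topologicalType} (x0 : T).
Implicit Types f g h : R -> T.

Definition is_loop f : Prop :=
  [/\ {within `[0, 1], continuous f}, f 0 = x0 & f 1 = x0].

Definition homotopic f g : Prop := exists H : R * R -> T,
  [/\ {within `[0, 1] `*` `[0, 1], continuous H},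
      forall s, 0 <= s <= 1 -> H (s, 0) = f s,
      forall s, 0 <= s <= 1 -> H (s, 1) = g s,
      forall t, 0 <= t <= 1 -> H (0, t) = x0 &
      forall t, 0 <= t <= 1 -> H (1, t) = x0].

Definition concat f g : R -> T :=
  fun s => if s <= 2^-1 then f (2 * s) else g (2 * s - 1).

Definition reverse f : R -> T := fun s => f (1 - s).

Lemma within_comp (S S' : topologicalType) (A : set S) (B : set S')
    (phi : S -> S') (f : S' -> T) :
  continuous phi -> (forall x, A x -> B (phi x)) ->
  {within B, continuous f} -> {within A, continuous (f \o phi)}.
Proof.
move=> cphi AB /subspace_continuousP cf; apply/subspace_continuousP => x Ax.
apply: cvg_comp (cf _ (AB _ Ax)) => U.
rewrite /within /= => BU; have := cphi x _ BU; rewrite /nbhs/= => BU'.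
by apply: filterS BU' => y /= h Ay; apply: h; exact: AB.
Qed.

Lemma within_paste (S : topologicalType) (A B D : set S) (f g h : S -> T) :
  closed A -> closed B -> D `<=` A `|` B ->
  (forall x, A x -> h x = f x) -> (forall x, B x -> h x = g x) ->
  {within A, continuous f} -> {within B, continuous g} ->
  {within D, continuous h}.
Proof.
move=> cA cB DAB hf hg cf cg; apply: (continuous_subspaceW DAB).
apply: withinU_continuous => //.
  by apply: (@subspace_eq_continuous _ A _ f) cf => x; rewrite inE => Ax; rewrite /from_subspace hf.
by apply: (@subspace_eq_continuous _ B _ g) cg => x; rewrite inE => Ax; rewrite /from_subspace hg.
Qed.

Lemma closedX (A B : set R) : closed A -> closed B -> closed (A `*` B).
Proof.
move=> cA cB; rewrite (_ : A `*` B = (@fst R R) @^-1` A `&` (@snd R R) @^-1` B)//.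
by apply: closedI; apply: preimage_closed => // x _; [exact: cvg_fst|exact: cvg_snd].
Qed.

Let aff (a b s : R) : R := a * s + b.
Let aff2 (a b c d : R) (p : R * R) := (aff a b p.1, aff c d p.2).

Lemma aff_cts a b : continuous (aff a b).
Proof.
move=> s; apply: cvgD; last exact: cvg_cst.
by apply: cvgM; [exact: cvg_cst|exact: cvg_id].
Qed.

Lemma aff2_cts a b c d : continuous (aff2 a b c d).
Proof.
move=> p.
have h1 : {for p, continuous (aff a b \o fst)}.
  by apply: continuous_comp; [exact: cvg_fst|exact: aff_cts].
have h2 : {for p, continuous (aff c d \o snd)}.
  by apply: continuous_comp; [exact: cvg_snd|exact: aff_cts].
exact: (cvg_pair h1 h2).
Qed.

Lemma concat_is_loop f g : is_loop f -> is_loop g -> is_loop (concat f g).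
Proof.
move=> [cf f0 f1] [cg g0 g1]; split; last 2 first.
- by rewrite /concat ifT ?mulr0 // invr_ge0.
- rewrite /concat ifF; first by rewrite (_ : 2 * 1 - 1 = 1) //; lra.
  by apply/negbTE; rewrite -ltNge; lra.
apply: (@within_paste R `[0, 2^-1]%classic `[2^-1, 1]%classic `[0, 1]%classic
  (f \o aff 2 0) (g \o aff 2 (-1))).
- exact: interval_closed.
- exact: interval_closed.
- move=> s; rewrite /= !in_itv/= => /andP[s0 s1].
  by case: (leP s 2^-1) => h; [left|right]; rewrite ?s0 ?s1 //= (ltW h).
- by move=> s /=; rewrite in_itv/= /concat /aff addr0 => /andP[_ ->].
- move=> s /=; rewrite in_itv/= /concat /aff => /andP[s0 s1].
  case: ifP => // h; have -> : s = 2^-1 by apply/eqP; rewrite eq_le s0 h.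
  by rewrite (_ : 2 * _ = 1 :> R); [rewrite subrr f1 g0 | lra].
- apply: within_comp cf => [|s]; first exact: aff_cts.
  by rewrite /= !in_itv/= /aff; lra.
- apply: within_comp cg => [|s]; first exact: aff_cts.
  by rewrite /= !in_itv/= /aff; lra.
Qed.

Lemma reverse_is_loop f : is_loop f -> is_loop (reverse f).
Proof.
move=> [cf f0 f1]; split; rewrite /reverse ?subr0 ?subrr //.
rewrite (_ : (fun _ => _) = f \o aff (-1) 1); last first.
  by apply/funext => s /=; rewrite /aff mulN1r addrC.
apply: within_comp cf => [|s]; first exact: aff_cts.
by rewrite /= !in_itv/= /aff; lra.
Qed.

Lemma cst_is_loop : is_loop (cst x0).
Proof. by split => //; apply: continuous_subspaceT => s; exact: cvg_cst. Qed.

Lemma homotopic_eq f g : is_loop f -> (forall s, 0 <= s <= 1 -> f s = g s) ->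
  homotopic f g.
Proof.
move=> [cf f0 f1] fg; exists (f \o fst); split => //=.
by apply: within_comp cf => [x|[s t] []//]; exact: cvg_fst.
Qed.

Lemma homotopic_sym f g : homotopic f g -> homotopic g f.
Proof.
move=> [H [cH Hf Hg H0 H1]]; exists (H \o aff2 1 0 (-1) 1); split.
- apply: within_comp cH => [|[s t]]; first exact: aff2_cts.
  by rewrite /= !in_itv/= /aff; lra.
- by move=> s s01; rewrite /= /aff2/aff/= mul1r mulr0 addr0 add0r Hg.
- by move=> s s01; rewrite /= /aff2/aff/= mul1r mulr1 addr0 addNr Hf.
- by move=> t t01; rewrite /= /aff2/aff/= mulr0 addr0 H0//; lra.
- by move=> t t01; rewrite /= /aff2/aff/= mulr1 addr0 H1//; lra.
Qed.

Lemma homotopic_trans f g h :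
  homotopic f g -> homotopic g h -> homotopic f h.
Proof.
move=> [H [cH Hf Hg H0 H1]] [K [cK Kg Kh K0 K1]].
exists (fun p => if p.2 <= 2^-1 then H (p.1, 2 * p.2)
                 else K (p.1, 2 * p.2 - 1)); split => /=.
- apply: (@within_paste (R * R)%type (`[0, 1] `*` `[0, 2^-1])
    (`[0, 1] `*` `[2^-1, 1]) (`[0, 1] `*` `[0, 1])
    (H \o aff2 1 0 2 0) (K \o aff2 1 0 2 (-1))).
  + by apply: closedX; exact: interval_closed.
  + by apply: closedX; exact: interval_closed.
  + move=> [s t]; rewrite /= !in_itv/= => -[s01 /andP[t0 t1]].
    case: (leP t 2^-1) => h'; [left|right]; split => //; lra.
  + move=> [s t] /=; rewrite !in_itv/= => -[_ /andP[_ ->]].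
    by rewrite /aff2/aff/= mul1r !addr0.
  + move=> [s t] /=; rewrite !in_itv/= => -[s01 /andP[t0 t1]].
    rewrite /aff2/aff/= mul1r !addr0; case: ifP => // h'.
    have -> : t = 2^-1 by apply/eqP; rewrite eq_le t0 h'.
    by rewrite (_ : 2 * _ = 1 :> R); [rewrite subrr Hg// Kg | lra].
  + apply: within_comp cH => [|[s t]]; first exact: aff2_cts.
    by rewrite /= !in_itv/= /aff; lra.
  + apply: within_comp cK => [|[s t]]; first exact: aff2_cts.
    by rewrite /= !in_itv/= /aff; lra.
- by move=> s s01; rewrite invr_ge0 ler0n mulr0 Hf.
- move=> s s01; rewrite ifF; last by apply/negbTE; rewrite -ltNge; lra.
  by rewrite (_ : 2 * 1 - 1 = 1) ?Kh//; lra.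
- move=> t t01; case: ifPn => [h'|]; first by rewrite H0//; lra.
  by rewrite -ltNge => h'; rewrite K0//; lra.
- move=> t t01; case: ifPn => [h'|]; first by rewrite H1//; lra.
  by rewrite -ltNge => h'; rewrite K1//; lra.
Qed.

Lemma homotopic_concat f f' g g' : homotopic f f' -> homotopic g g' ->
  homotopic (concat f g) (concat f' g').
Proof.
move=> [H [cH Hf Hf' H0 H1]] [K [cK Kg Kg' K0 K1]].
exists (fun p => if p.1 <= 2^-1 then H (2 * p.1, p.2)
                 else K (2 * p.1 - 1, p.2)); split => /=.
- apply: (@within_paste (R * R)%type (`[0, 2^-1] `*` `[0, 1])
    (`[2^-1, 1] `*` `[0, 1]) (`[0, 1] `*` `[0, 1])
    (H \o aff2 2 0 1 0) (K \o aff2 2 (-1) 1 0)).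
  + by apply: closedX; exact: interval_closed.
  + by apply: closedX; exact: interval_closed.
  + move=> [s t]; rewrite /= !in_itv/= => -[/andP[s0 s1] t01].
    case: (leP s 2^-1) => h'; [left|right]; split => //; lra.
  + move=> [s t] /=; rewrite !in_itv/= => -[/andP[_ ->] _].
    by rewrite /aff2/aff/= mul1r !addr0.
  + move=> [s t] /=; rewrite !in_itv/= => -[/andP[s0 s1] t01].
    rewrite /aff2/aff/= mul1r !addr0; case: ifP => // h'.
    have -> : s = 2^-1 by apply/eqP; rewrite eq_le s0 h'.
    by rewrite (_ : 2 * _ = 1 :> R); [rewrite subrr H1// K0 | lra].
  + apply: within_comp cH => [|[s t]]; first exact: aff2_cts.
    by rewrite /= !in_itv/= /aff; lra.
  + apply: within_comp cK => [|[s t]]; first exact: aff2_cts.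
    by rewrite /= !in_itv/= /aff; lra.
- move=> s s01; rewrite /concat; case: ifPn => [h'|]; first by rewrite Hf//; lra.
  by rewrite -ltNge => h'; rewrite Kg//; lra.
- move=> s s01; rewrite /concat; case: ifPn => [h'|]; first by rewrite Hf'//; lra.
  by rewrite -ltNge => h'; rewrite Kg'//; lra.
- by move=> t t01; rewrite invr_ge0 ler0n mulr0 H0.
- move=> t t01; rewrite ifF; last by apply/negbTE; rewrite -ltNge; lra.
  by rewrite (_ : 2 * 1 - 1 = 1) ?K1//; lra.
Qed.

Lemma homotopic_reverse f g : homotopic f g ->
  homotopic (reverse f) (reverse g).
Proof.
move=> [H [cH Hf Hg H0 H1]]; exists (H \o aff2 (-1) 1 1 0); split.
- apply: within_comp cH => [|[s t]]; first exact: aff2_cts.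
  by rewrite /= !in_itv/= /aff; lra.
- move=> s s01; rewrite /= /aff2/aff/= mul1r addr0 Hf; last by lra.
  by rewrite /reverse mulN1r addrC.
- move=> s s01; rewrite /= /aff2/aff/= mul1r addr0 Hg; last by lra.
  by rewrite /reverse mulN1r addrC.
- by move=> t t01; rewrite /= /aff2/aff/= mulr0 add0r mul1r addr0 H1.
- by move=> t t01; rewrite /= /aff2/aff/= mulr1 addNr mul1r addr0 H0.
Qed.

Lemma homotopic_reparam f (phi psi : R -> R) : is_loop f ->
  continuous phi -> continuous psi ->
  (forall s, 0 <= s <= 1 -> 0 <= phi s <= 1) ->
  (forall s, 0 <= s <= 1 -> 0 <= psi s <= 1) ->
  phi 0 = psi 0 -> phi 1 = psi 1 ->
  f (phi 0) = x0 -> f (phi 1) = x0 -> homotopic (f \o phi) (f \o psi).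
Proof.
move=> [cf f0 f1] cphi cpsi phi01 psi01 e0 e1 h0 h1.
pose F (p : R * R) : R := (1 - p.2) * phi p.1 + p.2 * psi p.1.
have cF : continuous F.
  move=> p; apply: cvgD; apply: cvgM.
  - by apply: cvgB; [exact: cvg_cst|exact: cvg_snd].
  - by apply: (@cvg_comp _ _ _ fst phi); [exact: cvg_fst|exact: cphi].
  - exact: cvg_snd.
  - by apply: (@cvg_comp _ _ _ fst psi); [exact: cvg_fst|exact: cpsi].
exists (f \o F); split; rewrite /F /=.
- apply: within_comp cf => // -[s t]; rewrite /= !in_itv/= => -[s01 t01].
  by have := phi01 s s01; have := psi01 s s01; rewrite /F/=; nra.
- by move=> s _; rewrite subr0 mul1r mul0r addr0.
- by move=> s _; rewrite subrr mul1r mul0r add0r.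
- by move=> t _; rewrite -e0 -mulrDl subrK mul1r.
- by move=> t _; rewrite -e1 -mulrDl subrK mul1r.
Qed.


Lemma homotopic_of_eq f (phi psi : R -> R) g h : is_loop f ->
  is_loop g -> is_loop h ->
  continuous phi -> continuous psi ->
  (forall s, 0 <= s <= 1 -> 0 <= phi s <= 1) ->
  (forall s, 0 <= s <= 1 -> 0 <= psi s <= 1) ->
  phi 0 = psi 0 -> phi 1 = psi 1 ->
  (forall s, 0 <= s <= 1 -> g s = f (phi s)) ->
  (forall s, 0 <= s <= 1 -> h s = f (psi s)) -> homotopic g h.
Proof.
move=> lf lg lh cphi cpsi phi01 psi01 e0 e1 gE hE.
have [_ g0 g1] := lg; have [_ h0 h1] := lh.
have le01 : 0 <= (0 : R) <= 1 by lra.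
have le11 : 0 <= (1 : R) <= 1 by lra.
apply: homotopic_trans (homotopic_eq lg gE) _.
apply: homotopic_trans _ (homotopic_sym (homotopic_eq lh hE)).
by apply: homotopic_reparam => //; rewrite -gE.
Qed.

Let id_cts : continuous (id : R -> R).
Proof. by move=> s; exact: cvg_id. Qed.

Let min_cts (u v : R -> R) : continuous u -> continuous v ->
  continuous (fun s => Num.min (u s) (v s)).
Proof. by move=> cu cv s; apply: continuous_min; [exact: cu|exact: cv]. Qed.

Let max_cts (u v : R -> R) : continuous u -> continuous v ->
  continuous (fun s => Num.max (u s) (v s)).
Proof. by move=> cu cv s; apply: continuous_max; [exact: cu|exact: cv]. Qed.

Let cst_cts (a : R) : continuous (fun _ : R => a).
Proof. by move=> s; exact: cvg_cst. Qed.

Lemma homotopic_refl f : is_loop f -> homotopic f f.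
Proof. by move=> lf; apply: homotopic_eq. Qed.

Lemma concatA f g h : is_loop f -> is_loop g -> is_loop h ->
  homotopic (concat f (concat g h)) (concat (concat f g) h).
Proof.
move=> lf lg lh; apply: homotopic_sym.
have lgh := concat_is_loop lg lh; have lfg := concat_is_loop lf lg.
pose phi s := Num.min (aff 2 0 s) (Num.min (aff 1 4^-1 s) (aff 2^-1 2^-1 s)).
have phiE s : 0 <= s -> [\/ s <= 4^-1 /\ phi s = 2 * s,
    4^-1 < s <= 2^-1 /\ phi s = s + 4^-1 |
    2^-1 < s /\ phi s = 2^-1 * s + 2^-1].
  move=> s0; rewrite /phi /aff.
  have [h1|h1] := leP s 4^-1; [|have [h2|h2] := leP s 2^-1].
  - apply: Or31; split => //.
    by rewrite min_l ?addr0// le_min; apply/andP; split; lra.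
  - apply: Or32; split; first lra.
    have -> : Num.min (1 * s + 4^-1) (2^-1 * s + 2^-1) = s + 4^-1.
      by rewrite min_l ?mul1r//; lra.
    by rewrite min_r//; lra.
  - apply: Or33; split => //.
    have -> : Num.min (1 * s + 4^-1) (2^-1 * s + 2^-1) = 2^-1 * s + 2^-1.
      by rewrite min_r//; lra.
    by rewrite min_r//; lra.
apply: (@homotopic_of_eq (concat f (concat g h)) phi id) => //.
- exact: concat_is_loop.
- exact: concat_is_loop.
- exact: concat_is_loop.
- apply: min_cts; first exact: aff_cts.
  by apply: min_cts; exact: aff_cts.
- by move=> s s01; case: (phiE s); [lra|lra..].
- by case: (phiE 0) => // -[]; lra.
- by case: (phiE 1); [lra|move=> []; lra..].
- move=> s /andP[s0 s1]; rewrite /concat; case: (phiE s) => // -[h1 ->].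
  + by rewrite !ifT; [congr f; lra|lra..].
  + rewrite ifT; last by lra.
    rewrite ifF; last by apply/negbTE; rewrite -ltNge; lra.
    rewrite ifF; last by apply/negbTE; rewrite -ltNge; lra.
    by rewrite ifT; [congr g; lra|lra].
  + rewrite !ifF; last 3 first.
    by apply/negbTE; rewrite -ltNge; lra.
    by apply/negbTE; rewrite -ltNge; lra.
    by apply/negbTE; rewrite -ltNge; lra.
    by congr h; lra.
Qed.

Lemma concat1f f : is_loop f -> homotopic (concat (cst x0) f) f.
Proof.
move=> lf; have [_ f0 f1] := lf.
apply: (@homotopic_of_eq f (fun s => Num.max 0 (aff 2 (-1) s)) id) => //.
- by apply: concat_is_loop => //; exact: cst_is_loop.
- by apply: max_cts; [exact: cst_cts|exact: aff_cts].
- by move=> s s01; rewrite /aff; case: (leP 0 (2 * s + -1)) => hs; lra.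
- by rewrite /aff/= max_l; lra.
- by rewrite /aff/= max_r; lra.
- move=> s s01; rewrite /concat /aff; case: ifP => h.
    by rewrite max_l ?f0//; lra.
  by rewrite max_r//; move/negbT: h; rewrite -ltNge; lra.
Qed.

Lemma concatf1 f : is_loop f -> homotopic (concat f (cst x0)) f.
Proof.
move=> lf; have [_ f0 f1] := lf.
apply: (@homotopic_of_eq f (fun s => Num.min (aff 2 0 s) 1) id) => //.
- by apply: concat_is_loop => //; exact: cst_is_loop.
- by apply: min_cts; [exact: aff_cts|exact: cst_cts].
- by move=> s s01; rewrite /aff; case: (leP (2 * s + 0) 1) => hs; lra.
- by rewrite /aff/= min_l; lra.
- by rewrite /aff/= min_r; lra.
- move=> s s01; rewrite /concat /aff addr0; case: ifP => h.
    by rewrite min_l//; lra.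
  by rewrite min_r ?f1//; move/negbT: h; rewrite -ltNge; lra.
Qed.

Lemma concatVf f : is_loop f -> homotopic (concat (reverse f) f) (cst x0).
Proof.
move=> lf; have [_ f0 f1] := lf.
apply: (@homotopic_of_eq f
  (fun s => Num.max (aff (-2) 1 s) (aff 2 (-1) s)) (fun _ => 1)) => //.
- by apply: concat_is_loop => //; exact: reverse_is_loop.
- exact: cst_is_loop.
- by apply: max_cts; exact: aff_cts.
- by move=> s s01; rewrite /aff; case: (leP (-2 * s + 1) (2 * s + -1)) => hs; lra.
- by move=> s _; rewrite lexx ler01.
- by rewrite /aff/= max_l; lra.
- by rewrite /aff/= max_r; lra.
- move=> s s01; rewrite /concat /reverse /aff; case: ifP => h.
    by rewrite max_l; [congr f; lra|lra].
  by rewrite max_r//; move/negbT: h; rewrite -ltNge; lra.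
Qed.

Lemma concatfV f : is_loop f -> homotopic (concat f (reverse f)) (cst x0).
Proof.
move=> lf; have [_ f0 f1] := lf.
apply: (@homotopic_of_eq f
  (fun s => Num.min (aff 2 0 s) (aff (-2) 2 s)) (fun _ => 0)) => //.
- by apply: concat_is_loop => //; exact: reverse_is_loop.
- exact: cst_is_loop.
- by apply: min_cts; exact: aff_cts.
- by move=> s s01; rewrite /aff; case: (leP (2 * s + 0) (-2 * s + 2)) => hs; lra.
- by move=> s _; rewrite lexx ler01.
- by rewrite /aff/= min_l; lra.
- by rewrite /aff/= min_r; lra.
- move=> s s01; rewrite /concat /reverse /aff addr0; case: ifP => h.
    by rewrite min_l//; lra.
  rewrite min_r; last by move/negbT: h; rewrite -ltNge; lra.
  by congr f; lra.
Qed.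

End Loops.

Section Pi1.
Context (R : realType) {T : topologicalType} (x0 : T).

Definition loop := {f : R -> T | is_loop x0 f}.
HB.instance Definition _ := gen_eqMixin loop.
HB.instance Definition _ := gen_choiceMixin loop.

Definition loop_homotopic (f g : loop) : bool :=
  `[< homotopic x0 (sval f) (sval g) >].

Lemma loop_homotopic_equiv : equiv_class_of loop_homotopic.
Proof.
split=> [f|f g|g f h].
- by apply/asboolP; apply: homotopic_refl; exact: svalP.
- by apply/asboolP/asboolP; exact: homotopic_sym.
- by move=> /asboolP fg /asboolP gh; apply/asboolP; exact: homotopic_trans fg gh.
Qed.
Canonical loop_homotopic_equivRel := EquivRelPack loop_homotopic_equiv.

Definition pi1 := {eq_quot loop_homotopic}.
HB.instance Definition _ := EqQuotient.on pi1.
HB.instance Definition _ := Choice.on pi1.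

Definition loop_class (f : R -> T) (lf : is_loop x0 f) : pi1 :=
  \pi_pi1 (exist _ f lf).

Lemma loop_classP f g (lf : is_loop x0 f) (lg : is_loop x0 g) :
  loop_class lf = loop_class lg <-> homotopic x0 f g.
Proof.
split=> [/eqP|fg]; first by rewrite eqmodE => /asboolP.
by apply/eqP; rewrite eqmodE; apply/asboolP.
Qed.

Let rep (a : pi1) : R -> T := sval (repr a).
Let repP (a : pi1) : is_loop x0 (rep a). Proof. exact: svalP. Qed.

Let loop_class_rep a : loop_class (repP a) = a.
Proof.
have E (l : loop) p : exist _ (sval l) p = l.
  by case: l p => f lf p; congr exist; exact: Prop_irrelevance.
by rewrite -[RHS]reprK /loop_class E.
Qed.

Let rep_class f (lf : is_loop x0 f) : homotopic x0 (rep (loop_class lf)) f.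
Proof. by apply/(loop_classP (repP _) lf); rewrite loop_class_rep. Qed.

Definition pi1_one : pi1 := loop_class (cst_is_loop x0).
Definition pi1_inv (a : pi1) : pi1 := loop_class (reverse_is_loop (repP a)).
Definition pi1_mul (a b : pi1) : pi1 :=
  loop_class (concat_is_loop (repP a) (repP b)).

Lemma pi1_mulA : associative pi1_mul.
Proof.
move=> a b c; apply/loop_classP.
apply: homotopic_trans (homotopic_concat (homotopic_refl (repP a)) (rep_class _)) _.
apply: homotopic_trans (concatA (repP a) (repP b) (repP c)) _.
apply: homotopic_concat; last exact: homotopic_refl.
by apply: homotopic_sym; exact: rep_class.
Qed.

Lemma pi1_mul1 : left_id pi1_one pi1_mul.
Proof.
move=> a; rewrite -[RHS]loop_class_rep; apply/loop_classP.
apply: homotopic_trans (homotopic_concat (rep_class _) (homotopic_refl (repP a))) _.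
exact: concat1f.
Qed.

Lemma pi1_mulr1 : right_id pi1_one pi1_mul.
Proof.
move=> a; rewrite -[RHS]loop_class_rep; apply/loop_classP.
apply: homotopic_trans (homotopic_concat (homotopic_refl (repP a)) (rep_class _)) _.
exact: concatf1.
Qed.

Lemma pi1_mulV : left_inverse pi1_one pi1_inv pi1_mul.
Proof.
move=> a; apply/loop_classP.
apply: homotopic_trans (homotopic_concat (rep_class _) (homotopic_refl (repP a))) _.
exact: concatVf.
Qed.

Lemma pi1_mulrV : right_inverse pi1_one pi1_inv pi1_mul.
Proof.
move=> a; apply/loop_classP.
apply: homotopic_trans (homotopic_concat (homotopic_refl (repP a)) (rep_class _)) _.
exact: concatfV.
Qed.

HB.instance Definition _ :=
  isGroup.Build pi1 pi1_mulA pi1_mul1 pi1_mulr1 pi1_mulV pi1_mulrV.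

End Pi1.

Section NormalQuotient.
Context {G : groupType}.
Local Open Scope group_scope.

Definition subgroup (K : set G) : Prop :=
  [/\ K 1, forall x y, K x -> K y -> K (x * y) & forall x, K x -> K x^-1].

Definition normal_subgroup (K : set G) : Prop :=
  subgroup K /\ forall x y, K x -> K (x ^ y).

Definition normal_closure (A : set G) : set G :=
  \bigcap_(K in [set K | normal_subgroup K /\ A `<=` K]) K.

Lemma normal_closure_normal A : normal_subgroup (normal_closure A).
Proof.
split; first split=> [K [[[]]]//|x y Kx Ky K hK|x Kx K hK];
  last move=> x y Kx K hK; have [[[K1 KM KV] KJ] _] := hK.
- by apply: KM; [exact: Kx|exact: Ky].
- by apply: KV; exact: Kx.
- by apply: KJ; exact: Kx.
Qed.

Definition cosetrel (A : set G) (x y : G) : bool :=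
  `[< normal_closure A (x^-1 * y) >].

Lemma cosetrel_equiv A : equiv_class_of (cosetrel A).
Proof.
have [[N1 NM NV] NJ] := normal_closure_normal A.
split=> [x|x y|y x z].
- by apply/asboolP; rewrite mulVg.
- by apply/asboolP/asboolP => /NV; rewrite invgM invgK.
- move=> /asboolP xy /asboolP yz; apply/asboolP.
  by have := NM _ _ xy yz; rewrite mulgA mulgK.
Qed.
Canonical cosetrel_equivRel A := EquivRelPack (cosetrel_equiv A).

Definition nquot (A : set G) := {eq_quot cosetrel A}.
HB.instance Definition _ A := EqQuotient.on (nquot A).
HB.instance Definition _ A := Choice.on (nquot A).

Definition nproj (A : set G) (x : G) : nquot A := \pi_(nquot A) x.

Lemma nprojP A x y : nproj A x = nproj A y <-> normal_closure A (x^-1 * y).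
Proof.
split=> [/eqP|xy]; first by rewrite eqmodE => /asboolP.
by apply/eqP; rewrite eqmodE; apply/asboolP.
Qed.

Let nproj_repr A (a : nquot A) : nproj A (repr a) = a.
Proof. exact: reprK. Qed.

Definition nquot_one A : nquot A := nproj A 1.
Definition nquot_inv A (a : nquot A) : nquot A := nproj A (repr a)^-1.
Definition nquot_mul A (a b : nquot A) : nquot A := nproj A (repr a * repr b).

Let nquot_mulE A x y : nquot_mul (nproj A x) (nproj A y) = nproj A (x * y).
Proof.
have [[N1 NM NV] NJ] := normal_closure_normal A.
apply/nprojP; rewrite invgM.
have /nprojP hx : nproj A (repr (nproj A x)) = nproj A x by exact: nproj_repr.
have /nprojP hy : nproj A (repr (nproj A y)) = nproj A y by exact: nproj_repr.
have := NM _ _ (NJ _ (repr (nproj A y)) hx) hy.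
by rewrite /conjg !mulgA mulgK.
Qed.

Let nquot_invE A x : nquot_inv (nproj A x) = nproj A x^-1.
Proof.
have [[N1 NM NV] NJ] := normal_closure_normal A.
apply/nprojP; rewrite invgK.
have /nprojP hx : nproj A (repr (nproj A x)) = nproj A x by exact: nproj_repr.
by have := NJ _ x^-1 (NV _ hx); rewrite invgM invgK /conjg invgK !mulgA mulgV mul1g.
Qed.

Lemma nquot_mulA A : associative (@nquot_mul A).
Proof.
move=> a b c; rewrite -(nproj_repr a) -(nproj_repr b) -(nproj_repr c).
by rewrite !nquot_mulE mulgA.
Qed.

Lemma nquot_mul1 A : left_id (nquot_one A) (@nquot_mul A).
Proof. by move=> a; rewrite -(nproj_repr a) nquot_mulE mul1g. Qed.

Lemma nquot_mulr1 A : right_id (nquot_one A) (@nquot_mul A).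
Proof. by move=> a; rewrite -(nproj_repr a) nquot_mulE mulg1. Qed.

Lemma nquot_mulV A : left_inverse (nquot_one A) (@nquot_inv A) (@nquot_mul A).
Proof. by move=> a; rewrite -(nproj_repr a) nquot_invE nquot_mulE mulVg. Qed.

Lemma nquot_mulrV A : right_inverse (nquot_one A) (@nquot_inv A) (@nquot_mul A).
Proof. by move=> a; rewrite -(nproj_repr a) nquot_invE nquot_mulE mulgV. Qed.

HB.instance Definition _ A := isGroup.Build (nquot A)
  (@nquot_mulA A) (@nquot_mul1 A) (@nquot_mulr1 A) (@nquot_mulV A)
  (@nquot_mulrV A).

Lemma nproj_is_multiplicative A : {morph nproj A : x y / x * y}.
Proof. by move=> x y; rewrite -nquot_mulE. Qed.
HB.instance Definition _ A :=
  isMultiplicative.Build G (nquot A) (nproj A) (@nproj_is_multiplicative A).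

End NormalQuotient.

(* Bundled so that it inherits the topology and the normed module structure
   that the library puts on any numFieldType. *)
Definition Cplx (R : realType) : numClosedFieldType := R[i]%C.

Section ProjectiveSpace.
Context (R : realType).
Local Notation C := (Cplx R).

Definition nonzero n : Type := [set v : 'rV[C]_n.+1 | v != 0].
HB.instance Definition _ n := SubChoice.on (nonzero n).
HB.instance Definition _ n := Topological.on (nonzero n).

Definition proportional n (u v : nonzero n) : bool := (val u == val v)%MS.

Lemma proportional_equiv n : equiv_class_of (@proportional n).
Proof.
split=> [u|u v|v u w]; rewrite /proportional.
- by rewrite submx_refl.
- by rewrite andbC.
- by move=> /andP[uv vu] /andP[vw wv]; rewrite (submx_trans uv) ?(submx_trans wv).
Qed.
Canonical proportional_equivRel n := EquivRelPack (proportional_equiv n).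

Definition CP n := quotient_topology {eq_quot (@proportional n)}.
HB.instance Definition _ n := Quotient.on (CP n).
HB.instance Definition _ n := Choice.on (CP n).
HB.instance Definition _ n := Topological.on (CP n).

Lemma e0_subproof n : (delta_mx 0 0 : 'rV[C]_n.+1) \in [set v | v != 0].
Proof.
rewrite inE; apply/eqP => /matrixP/(_ 0 0).
by rewrite !mxE !eqxx => /eqP; rewrite oner_eq0.
Qed.

(* The point with homogeneous coordinates v; junk value when v = 0. *)
Definition point_of n (v : 'rV[C]_n.+1) : CP n :=
  \pi_(CP n) (insubd (Sub (delta_mx 0 0) (e0_subproof n) : nonzero n) v).

Definition hcoord n (x : CP n) : 'rV[C]_n.+1 := val (repr x).

Lemma hcoord_neq0 n (x : CP n) : hcoord x != 0.
Proof. by have := valP (repr x); rewrite inE. Qed.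

Lemma hcoordK n (x : CP n) : point_of (hcoord x) = x.
Proof. by rewrite /point_of /hcoord valKd reprK. Qed.

Lemma point_ofP n (u v : 'rV[C]_n.+1) : u != 0 -> v != 0 ->
  (point_of u = point_of v) <-> (u == v)%MS.
Proof.
move=> u0 v0.
have E w : w != 0 -> val (insubd (Sub (delta_mx 0 0) (e0_subproof n) : nonzero n) w) = w.
  by move=> w0; rewrite insubdK// inE.
pose Q := {eq_quot (@proportional n)}.
have H (a b : nonzero n) : \pi_Q a = \pi_Q b <-> proportional a b.
  split=> [/eqP|ab]; first by rewrite eqmodE.
  by apply/eqP; rewrite eqmodE.
by apply: (iff_trans (H _ _)); rewrite /proportional !E.
Qed.

End ProjectiveSpace.

Section Varieties.
Context {R : realType}.
Local Notation C := (Cplx R).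
Local Notation CP := (CP R).
Local Notation poly n := (mpoly n C).

Definition poly_eval n (g : poly n) (v : 'rV[C]_n) : C :=
  meval (fun i => v 0 i) g.

Definition poly_diff n (g : poly n) (v w : 'rV[C]_n) : C :=
  \sum_i poly_eval (mderiv i g) v * w 0 i.

Definition is_form n d (g : poly n) : Prop :=
  g \is ishomog1 d mdeg.

Definition vanishes N (g : poly N.+1) (X : set (CP N)) : Prop :=
  forall x, X x -> poly_eval g (hcoord x) = 0.

Definition algebraic N (X : set (CP N)) : Prop :=
  exists F : set (poly N.+1), (forall g, F g -> exists d, is_form d g) /\
    X = [set x | forall g, F g -> poly_eval g (hcoord x) = 0].

Definition irreducible N (X : set (CP N)) : Prop :=
  X !=set0 /\ forall d e (g h : poly N.+1), is_form d g -> is_form e h ->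
    vanishes (g * h) X -> vanishes g X \/ vanishes h X.

(* The Zariski tangent space of the affine cone over X at a point above x; its
   dimension is one more than that of the Zariski tangent space of X at x. *)
Definition cone_tangent N (X : set (CP N)) (x : CP N) : set 'rV[C]_N.+1 :=
  [set w | forall d (g : poly N.+1), is_form d g -> vanishes g X ->
    poly_diff g (hcoord x) w = 0].

Definition has_dim n k (W : set 'rV[C]_n) : Prop :=
  exists U : 'M[C]_(k, n), row_free U /\ W = [set w | (w <= U)%MS].

Definition smooth_surface N (X : set (CP N)) : Prop :=
  forall x, X x -> has_dim 3 (cone_tangent X x).

(* For irreducible X the dimension of X is the least dimension of its Zariski
   tangent spaces. *)
Definition projective_surface N (X : set (CP N)) : Prop :=
  [/\ algebraic X, irreducible X,
      exists2 x, X x & has_dim 3 (cone_tangent X x) &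
      forall x k, X x -> has_dim k (cone_tangent X x) -> (3 <= k)%N].

(* X meets a general codimension two linear subspace in n points. *)
Definition surface_degree N (X : set (CP N)) (n : nat) : Prop :=
  exists2 D : poly (N.+1 + N.+1), D != 0 &
    forall h k : 'rV[C]_N.+1, poly_eval D (row_mx h k) != 0 ->
      (X `&` [set x | hcoord x *m h^T = 0 /\ hcoord x *m k^T = 0] #= `I_n)%card.

Definition linproj N (L : 'M[C]_(N.+1, 3)) (x : CP N) : CP 2 :=
  point_of (hcoord x *m L).

Definition off_center N (L : 'M[C]_(N.+1, 3)) (X : set (CP N)) : Prop :=
  forall x, X x -> hcoord x *m L != 0.

(* u |-> [h u] is a holomorphic chart of the surface Y around y, centered at
   0, defined on the open set U of C^2. *)
Record chart N (Y : set (CP N)) (y : CP N) (U : set 'rV[C]_2)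
    (h : 'rV[C]_2 -> 'rV[C]_N.+1) : Prop := {
  chart_open : open U;
  chart_center : U 0 /\ point_of (h 0) = y;
  chart_holomorphic : forall u, U u -> differentiable h u;
  chart_neq0 : forall u, U u -> h u != 0;
  chart_inj : forall u v, U u -> U v ->
    point_of (h u) = point_of (h v) -> u = v;
  chart_immersion : forall u c v, U u -> c *: h u + 'd h u v = 0 -> v = 0;
  chart_image : forall u, U u -> Y (point_of (h u));
  chart_nbhs : exists W : set (CP N), [/\ open W, W y &
    forall z, W z -> Y z -> exists2 u, U u & z = point_of (h u)] }.

Definition vec2 (a b : C) : 'rV[C]_2 := \row_j (if j == 0 then a else b).

Definition etale_model (u : 'rV[C]_2) := u.
Definition fold_model1 (u : 'rV[C]_2) := vec2 (u 0 0) (u 0 1 ^+ 2).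
Definition fold_model2 (u : 'rV[C]_2) := vec2 (u 0 0 ^+ 2) (u 0 1).
Definition cusp_model (u : 'rV[C]_2) :=
  vec2 (u 0 0) (u 0 1 ^+ 3 + u 0 0 * u 0 1).

(* In a suitable chart of X around x and the chart p of the plane defined on V,
   the projection is the map m. *)
Definition local_form N (L : 'M[C]_(N.+1, 3)) (X : set (CP N))
    (V : set 'rV[C]_2) (p : 'rV[C]_2 -> 'rV[C]_3) (x : CP N)
    (m : 'rV[C]_2 -> 'rV[C]_2) : Prop :=
  exists U h, chart X x U h /\
    forall u, U u -> V (m u) /\ linproj L (point_of (h u)) = point_of (p (m u)).

(* Generic projection of a surface: a finite linear projection whose branch
   curve has at most ordinary nodes and cusps, and which over a point of the
   plane is respectively unramified, a simple fold, two simple folds crossing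
   normally, or a cusp. *)
Definition generic_projection N (L : 'M[C]_(N.+1, 3)) (X : set (CP N)) :=
  [/\ \rank L = 3%N, off_center L X &
   forall q, exists V p, chart setT q V p /\
     let fibre x := X x /\ linproj L x = q in
     let germ x m := local_form L X V p x m in
     [\/ forall x, fibre x -> germ x etale_model,
         exists x1, [/\ fibre x1, germ x1 fold_model1 &
           forall x, fibre x -> x <> x1 -> germ x etale_model],
         exists x1 x2, [/\ fibre x1 /\ fibre x2, x1 <> x2,
           germ x1 fold_model1, germ x2 fold_model2 &
           forall x, fibre x -> x <> x1 -> x <> x2 -> germ x etale_model] |
         exists x1, [/\ fibre x1, germ x1 cusp_model &
           forall x, fibre x -> x <> x1 -> germ x etale_model]]].

Definition branch_curve N (L : 'M[C]_(N.+1, 3)) (X : set (CP N)) :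
    set (CP 2) :=
  [set q | exists x, [/\ X x, linproj L x = q &
    exists w, [/\ cone_tangent X x w, w != 0 & w *m L = 0]]].

Definition galois_cover n N (L : 'M[C]_(N.+1, 3)) (X : set (CP N)) :
    set {ptws 'I_n -> CP N} :=
  closure [set z : {ptws 'I_n -> CP N} |
    [/\ forall i, X (z i), forall i j, linproj L (z i) = linproj L (z j) &
        forall i j, i != j -> z i <> z j]].

Section Planes.
Context (n N : nat) (P : 'I_n -> 'M[C]_(3, N.+1)).

(* The plane P i is the projectivization of the row space of the matrix. *)
Definition plane_union : set (CP N) :=
  [set x | exists i, (hcoord x <= P i)%MS].

(* The triangles K i have their vertices among the natural numbers.  The vertex
   k is realized by the point p k, the edge kl by the line through p k and p l,
   and two planes meet exactly in the face shared by their triangles. *)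
Definition shadow (K : 'I_n -> seq nat) : Prop :=
  (forall i, \rank (P i) = 3%N) /\
  exists p : nat -> 'rV[C]_N.+1, forall i j,
    (P i :&: P j :=: \sum_(k <- K i | k \in K j) <<p k>>)%MS.

Definition double_line (l : 'M[C]_N.+1) : Prop :=
  exists i j, [/\ i != j, l = (P i :&: P j)%MS & \rank l = 2%N].

(* Generic projection of a union of planes: finite, the images of the double
   lines are distinct, and three of them are concurrent only at the image of a
   point common to the three lines. *)
Definition generic_planes_projection (L : 'M[C]_(N.+1, 3)) : Prop :=
  [/\ \rank L = 3%N, off_center L plane_union,
   forall l m, double_line l -> double_line m ->
     (l *m L == m *m L)%MS -> (l == m)%MS &
   forall l1 l2 l3 x1 x2 x3,
     double_line l1 -> double_line l2 -> double_line l3 ->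
     ~~ (l1 == l2)%MS -> ~~ (l1 == l3)%MS -> ~~ (l2 == l3)%MS ->
     (hcoord x1 <= l1)%MS -> (hcoord x2 <= l2)%MS -> (hcoord x3 <= l3)%MS ->
     linproj L x1 = linproj L x2 -> linproj L x1 = linproj L x3 ->
     x1 = x2 /\ x1 = x3].

End Planes.

Definition map_eval M N (g : 'I_N.+1 -> poly M.+1) (x : CP M) : 'rV[C]_N.+1 :=
  \row_i poly_eval (g i) (hcoord x).

Definition regular_map M N (X : set (CP M)) (phi : CP M -> CP N) : Prop :=
  forall x, X x -> exists d (g : 'I_N.+1 -> poly M.+1),
    [/\ forall i, is_form d (g i), map_eval g x != 0 &
        forall y, X y -> map_eval g y != 0 -> phi y = point_of (map_eval g y)].

Definition isomorphism M N (X : set (CP M)) (Y : set (CP N))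
    (phi : CP M -> CP N) : Prop :=
  exists psi, [/\ regular_map X phi, regular_map Y psi,
    forall x, X x -> Y (phi x) /\ psi (phi x) = x &
    forall y, Y y -> X (psi y) /\ phi (psi y) = y].

Definition disc : set C := [set t | `|t| < 1].

(* Forms of degree d whose coefficients are holomorphic functions of t in D. *)
Definition form_family n (D : set C) d (g : C -> poly n) : Prop :=
  (forall t, D t -> is_form d (g t)) /\
  forall m t, D t -> differentiable (fun t => mcoeff m (g t) : C^o) (t : C^o).

(* A closed subscheme V of disc * CP^M, given by its homogeneous ideal I over
   the holomorphic functions on the disc.  Flatness over the disc amounts to
   the absence of torsion. *)
Record flat_family M (I : nat -> set (C -> poly M.+1)) : Prop := {
  family_form : forall d g, I d g -> form_family disc d g;
  family_0 : forall d, I d (fun=> 0);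
  family_add : forall d g h, I d g -> I d h -> I d (fun t => g t + h t);
  family_mul : forall d e g h, I d g -> form_family disc e h ->
    I (e + d)%N (fun t => h t * g t);
  family_flat : forall d c g, disc c -> form_family disc d g ->
    I d (fun t => (t - c) *: g t) -> I d g }.

Definition fibre M (I : nat -> set (C -> poly M.+1)) (t : C) : set (CP M) :=
  [set x | forall d g, I d g -> poly_eval (g t) (hcoord x) = 0].

(* The fibre at t is a reduced scheme: in large degrees, its equations are all
   the forms that vanish on its points. *)
Definition reduced_fibre M (I : nat -> set (C -> poly M.+1)) (t : C) : Prop :=
  exists d0, forall d f, (d0 <= d)%N -> is_form d f -> vanishes f (fibre I t) ->
    exists2 g, I d g & g t = f.

Definition family_map M (I : nat -> set (C -> poly M.+1))
    (F : C -> CP M -> CP 2) : Prop :=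
  forall t x, disc t -> fibre I t x -> exists D d (g : 'I_3 -> C -> poly M.+1),
    [/\ open D /\ D t, D `<=` disc, forall i, form_family D d (g i),
        map_eval (g^~ t) x != 0 &
        forall s y, D s -> fibre I s y -> map_eval (g^~ s) y != 0 ->
          F s y = point_of (map_eval (g^~ s) y)].

Definition projective_degeneration N0 (L0 : 'M[C]_(N0.+1, 3))
    (X0 : set (CP N0)) N (L : 'M[C]_(N.+1, 3)) (Y : set (CP N)) : Prop :=
  exists M (I : nat -> set (C -> poly M.+1)) (F : C -> CP M -> CP 2) t0
      (a0 : CP M -> CP N0) (a1 : CP M -> CP N),
    [/\ flat_family I /\ family_map I F,
        forall t, disc t -> t != 0 ->
          reduced_fibre I t /\ smooth_surface (fibre I t),
        disc t0 /\ t0 != 0,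
        [/\ reduced_fibre I 0, isomorphism (fibre I 0) X0 a0 &
            forall x, fibre I 0 x -> F 0 x = linproj L0 (a0 x)] &
        isomorphism (fibre I t0) Y a1 /\
        forall x, fibre I t0 x -> F t0 x = linproj L (a1 x)].

Definition degenerates_to_planes N (X : set (CP N)) n (K : 'I_n -> seq nat) :=
  exists (L : 'M[C]_(N.+1, 3)) N0 (P : 'I_n -> 'M[C]_(3, N0.+1)) L0,
    [/\ generic_projection L X, shadow P K, generic_planes_projection P L0 &
        projective_degeneration L0 (plane_union P) L X].

End Varieties.

Arguments galois_cover {R} n {N} L X.

Definition triangles : seq (seq nat) :=
  [:: [:: 1; 6; 4]; [:: 1; 4; 2]; [:: 1; 2; 5]; [:: 1; 5; 6];
      [:: 3; 4; 2]; [:: 3; 4; 7]; [:: 3; 7; 5]; [:: 3; 5; 2]]%N.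
Definition triangle (i : 'I_8) : seq nat := nth [::] triangles i.

Definition edges : seq (seq nat) :=
  [:: [:: 1; 6]; [:: 1; 4]; [:: 1; 5]; [:: 1; 2]; [:: 2; 4];
      [:: 2; 5]; [:: 2; 3]; [:: 3; 4]; [:: 3; 5]; [:: 3; 7]]%N.
(* Edges are numbered from 1. *)
Definition edge (i : nat) : seq nat := nth [::] edges i.-1.

Section Presentation.
Local Open Scope group_scope.
Context {G : groupType}.

Definition gcomm (x y : G) := x * y * x^-1 * y^-1.
Definition gtriple (x y : G) := x * y * x * y^-1 * x^-1 * y^-1.

Definition rel4 (a a' b b' c c' d d' : G) : Prop :=
  [/\ [/\ gtriple a' b = 1, gtriple a' b' = 1 & gtriple a' (b^-1 * b' * b) = 1],
      [/\ gtriple c d = 1, gtriple c' d = 1 & gtriple (c^-1 * c' * c) d = 1],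
      gcomm (b' * b * a' * b^-1 * b'^-1) d = 1 &
      gcomm (b' * b * a' * b^-1 * b'^-1)
           (c^-1 * c'^-1 * d^-1 * d' * d * c' * c) = 1] /\
  [/\ [/\ gtriple a b = 1, gtriple a b' = 1 & gtriple a (b^-1 * b' * b) = 1],
      [/\ gtriple c (d^-1 * d' * d) = 1, gtriple c' (d^-1 * d' * d) = 1 &
          gtriple (c^-1 * c' * c) (d^-1 * d' * d) = 1],
      gcomm (b' * b * a * b^-1 * b'^-1) (d^-1 * d' * d) = 1 &
      gcomm (b' * b * a * b^-1 * b'^-1)
           (c^-1 * c'^-1 * d^-1 * d'^-1 * d * d' * d * c' * c) = 1] /\
  [/\ b' * b * a' * b * a'^-1 * b^-1 * b'^-1 = d * c' * d^-1,
      b' * b * a' * b' * a'^-1 * b^-1 * b'^-1 = d * c' * c * c'^-1 * d^-1,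
      b' * b * a * b * a^-1 * b^-1 * b'^-1 =
        d^-1 * d' * d * c' * d^-1 * d'^-1 * d &
      b' * b * a * b' * a^-1 * b^-1 * b'^-1 =
        d^-1 * d' * d * c' * c * c'^-1 * d^-1 * d'^-1 * d].

Definition rel3 (a a' b b' c c' : G) : Prop :=
  [/\ [/\ gtriple a' b = 1, gtriple a' b' = 1 & gtriple a' (b^-1 * b' * b) = 1],
      a = b' * b * a' * b^-1 * b'^-1,
      [/\ gtriple c (b' * b * a' * b * a'^-1 * b^-1 * b'^-1) = 1,
          gtriple c (b' * b * a' * b' * a'^-1 * b^-1 * b'^-1) = 1 &
          gtriple c (b' * b * a' * b^-1 * b' * b * a'^-1 * b^-1 * b'^-1) = 1],
      c' = c * b' * b * a' * b' * b * a'^-1 * b^-1 * b'^-1 * c *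
           b' * b * a' * b^-1 * b'^-1 * a'^-1 * b^-1 * b'^-1 * c^-1 &
      [/\ gcomm a c = 1, gcomm a c' = 1, gcomm a' c = 1 & gcomm a' c' = 1]].

(* g i false and g i true stand for gamma_i and gamma_i', for 1 <= i <= 10. *)
Definition relations (g : nat -> bool -> G) : Prop :=
  let R4 i j k l := rel4 (g i false) (g i true) (g j false) (g j true)
                         (g k false) (g k true) (g l false) (g l true) in
  let R3 i j k := rel3 (g i false) (g i true) (g j false) (g j true)
                       (g k false) (g k true) in
  [/\ [/\ R4 1 2 3 4, R4 4 5 6 7 & R4 7 8 9 10]%N,
      (R3 2 5 8 /\ R3 3 6 9)%N,
      g 1%N false = g 1%N true /\ g 10%N false = g 10%N true,
      forall i j x y, (0 < i <= 10)%N -> (0 < j <= 10)%N ->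
        ~~ has (mem (edge i)) (edge j) -> gcomm (g i x) (g j y) = 1 &
      \prod_(k <- [:: 10; 9; 8; 7; 6; 5; 4; 3; 2; 1]%N) (g k true * g k false)
        = 1].

Definition squares (g : nat -> bool -> G) : set G :=
  [set x | exists i b, (0 < i <= 10)%N /\ x = g i b ^+ 2].

End Presentation.

Definition presented (G : groupType) (g : nat -> bool -> G) : Prop :=
  [/\ relations g,
      forall K : set G, subgroup K ->
        (forall i b, (0 < i <= 10)%N -> K (g i b)) -> K = setT &
      forall (H : groupType) (h : nat -> bool -> H), relations h ->
        exists f : {multiplicative G -> H},
          forall i b, (0 < i <= 10)%N -> f (g i b) = h i b].

(* The sequence 1 -> Pi -> G / <<g^2>> -> S_8 -> 1 is exact, and the second map
   sends g i b to the exchange of the two triangles sharing the edge i. *)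
Definition galois_sequence (Pi G : groupType) (g : nat -> bool -> G)
    (iota : {multiplicative Pi -> nquot (squares g)})
    (psi : {multiplicative nquot (squares g) -> 'S_8}) : Prop :=
  [/\ injective iota,
      forall q, psi q = 1%g <-> exists a, iota a = q,
      forall s, exists q, psi q = s &
      forall i b (s t : 'I_8), (0 < i <= 10)%N -> s != t ->
        {subset edge i <= triangle s} -> {subset edge i <= triangle t} ->
        psi (nproj (squares g) (g i b)) = tperm s t].

(* Main.v *)
Require Import Defs.
From mathcomp Require Import all_boot all_algebra all_fingroup.
From mathcomp Require Import boolp classical_sets reals topology.
From mathcomp Require Import zify.

Set Implicit Arguments.
Unset Strict Implicit.
Unset Printing Implicit Defensive.

Local Open Scope classical_set_scope.
Local Open Scope ring_scope.

(* Modulo the squares all generators are involutions, and it suffices to show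
   that the quotient Q is the symmetric group.  The relations at V_1 and V_3
   give 4 = 4' and 7 = 7'.  At V_3 the projective relation then yields
   [7, 10] = 1, so 9' commutes with 8 and 8'.  With u = 6'6, w = 8'8 and
   t = 9'9, the relations at V_5 make t a commutator of u that commutes with u;
   conjugating the projective relation by 9 then gives w^9 = tw and [t, w] = 1,
   while [9', w] = 1 forces t = 1.  From 9 = 9' every other pair collapses.
   The dual graph of the shadow is a ladder; the generators of a Hamiltonian
   path in it satisfy the Coxeter relations of S_8 and express the other three.
   Writing an element of Q in Coxeter normal form, its image in S_8 determines
   the factors one after the other, so that Q -> S_8 is injective. *)

(** * Braid relations and the local relations at vertices of multiplicity 4 and 3 *)

Section BraidRelations.
Local Open Scope group_scope.
Context {G : groupType}.
Implicit Types a b c d t u w x y z : G.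

Definition braid x y := x * y * x = y * x * y.

Lemma involK x : x^-1 = x -> cancel (mulg x) (mulg x).
Proof. by move=> xV y; rewrite -{1}xV mulKg. Qed.

Lemma invol_mul x : x^-1 = x -> x * x = 1.
Proof. by move=> xV; rewrite -{1}xV mulVg. Qed.

Lemma gtripleP x y : gtriple x y = 1 <-> braid x y.
Proof.
rewrite /gtriple /braid; split=> [/(congr1 (fun z => z * y * x * y))|->].
  by rewrite !mulgVK mul1g.
by rewrite !mulgK mulgV.
Qed.

Lemma gcommP x y : gcomm x y = 1 <-> commute x y.
Proof.
rewrite /gcomm /commute; split=> [/(congr1 (fun z => z * y * x))|->].
  by rewrite !mulgVK mul1g.
by rewrite !mulgK mulgV.
Qed.

Lemma braid_sym x y : braid x y -> braid y x.
Proof. by move=> /esym. Qed.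

Lemma braidA x y : braid x y ->
  forall z, x * (y * (x * z)) = y * (x * (y * z)).
Proof. by rewrite /braid => xy z; rewrite !mulgA xy. Qed.

Lemma braidJ x y z : braid (x ^ z) (y ^ z) <-> braid x y.
Proof. by rewrite /braid -!conjMg; split=> [/conjg_inj|->]. Qed.

Lemma braidE x y : braid x y -> x ^ y^-1 = y ^ x.
Proof.
move=> xy; rewrite /conjg invgK; apply: (mulgI x); apply: (mulIg y).
by rewrite !mulgA mulgVK mulgV mul1g xy.
Qed.

(** The braid relation rewrites [z ^ x^-1] as [x ^ z], and conjugation by [z] is injective. *)
Lemma braid_inj x y z : braid x z -> braid y z -> z ^ x^-1 = z ^ y^-1 -> x = y.
Proof.
by move=> /braid_sym/braidE-> /braid_sym/braidE-> /conjg_inj.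
Qed.

Lemma commuteJ x y z : commute (x ^ z) (y ^ z) <-> commute x y.
Proof. by rewrite /commute -!conjMg; split=> [/conjg_inj|->]. Qed.

Lemma commuteJE x y : commute x y -> x ^ y = x.
Proof. by move=> xy; rewrite /conjg xy mulKg. Qed.

Lemma conjg_invol x y : y^-1 = y -> (x ^ y) ^ y = x.
Proof. by move=> yV; rewrite -{1}yV conjgKV. Qed.

Lemma braid_conj x y : x^-1 = x -> braid x y -> x ^ y = y ^ x.
Proof. by move=> xV xy; rewrite -(braidE (braid_sym xy)) xV. Qed.

Lemma braid_conj2 x y : x^-1 = x -> y^-1 = y -> braid x y -> x ^ (x ^ y) = y.
Proof.
move=> xV yV xy; rewrite (braid_conj xV xy) [y ^ x]/conjg xV !conjgM.
rewrite [x ^ x]commuteJE//.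
by rewrite (braid_conj xV xy) conjg_invol.
Qed.

(* The reflections t, ut, u^2 t of an infinite dihedral group, each braided
   with y, generate with y a quotient of an affine group of type A_2, in which
   u and its conjugate are translations. *)
Lemma commute_translation y t u : y^-1 = y -> t^-1 = t -> u ^ t = u^-1 ->
  braid y t -> braid y (u * t) -> braid y (u * u * t) ->
  commute (u ^ y) u.
Proof.
move=> yV tV ut yt yut yuut.
have step v : v ^ t = v^-1 -> braid y (v * t) -> v ^ y = v * (v ^ y) ^ t.
  rewrite /braid /conjg yV tV => vt yvt.
  transitivity ((y * (v * t) * y) * (y * t * y)).
    by rewrite -!mulgA (involK yV) (involK tV).
  by rewrite yvt yt -!mulgA (involK tV).
(* The identities for [u] and [u * u] are compared: with [v = u ^ y] they combine to
   [v * v = u * v * u^-1 * v]. *)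
have e1 := step u ut yut.
have e2 : (u * u) ^ y = u * u * ((u * u) ^ y) ^ t.
  by apply: step => //; rewrite conjMg ut invgM.
have {}e1 : (u ^ y) ^ t = u^-1 * u ^ y by apply: (mulgI u); rewrite -e1 mulVKg.
move: e2; rewrite (conjMg u) (conjMg (u ^ y)) e1; move: (u ^ y) => v.
by rewrite !mulgA mulgK => /mulIg e2; rewrite /commute {1}e2 mulgVK.
Qed.

(** With [a' = a] two of the last four relations share their left side, so [d] and [d^-1 * d' * d],
    both braided with [c'], conjugate it alike. *)
Lemma rel4_right_eq a b b' c c' d d' : rel4 a a b b' c c' d d' -> d' = d.
Proof.
case=> [[_ [_ /gtripleP cd _] _ _] [[_ [_ /gtripleP cd' _] _ _]]].
case=> e1 _ e3 _.
have /(congr1 (fun z => z * d^-1)) : d * d = d' * d.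
  apply: (mulgI d^-1); rewrite !mulgA mulVg mul1g.
  apply: (@braid_inj d _ c'); try exact/braid_sym.
  by move: e3; rewrite e1 /conjg !invgM !invgK !mulgA.
by rewrite !mulgK.
Qed.

Lemma rel4_left_eq a a' b b' c c' d : rel4 a a' b b' c c' d d -> a' = a.
Proof.
case=> [[[/gtripleP ab' _ _] _ _ _] [[[/gtripleP ab _ _] _ _ _]]].
case=> e1 _; rewrite mulVg mul1g mulgVK -e1 => e3 _.
apply: (@braid_inj a' a b) => //; rewrite /conjg !invgK.
move: e3 => /mulIg/mulIg; rewrite -!mulgA => /mulgI/mulgI.
by rewrite !mulgA.
Qed.

(** Conjugated by [b' * b], the long commutator relation says that [a] commutes with [d ^ u]. *)
Lemma rel4_commute_outer a b b' c c' d : rel4 a a b b' c c' d d ->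
  let u := c' * c * (b' * b) in commute a u \/ commute d u -> commute a d.
Proof.
case=> [[_ _ _ /gcommP e] _] u; rewrite mulgVK in e.
have adu : commute a (d ^ u).
  apply/(commuteJ _ _ (b' * b)^-1).
  by move: e; rewrite -conjgM /u mulgK /conjg !invgM !invgK !mulgA.
by case=> /commuteJE uE; [apply/(commuteJ _ _ u)|]; move: adu; rewrite uE.
Qed.

Lemma rel4_conj a b b' c c' d :
  a^-1 = a -> b^-1 = b -> b'^-1 = b' -> d^-1 = d ->
  rel4 a a b b' c c' d d -> a ^ b' = c' ^ d.
Proof.
move=> aV bV b'V dV [_ [[[/gtripleP ab _ _] _ _ _] [e _ _ _]]].
move: e; rewrite /conjg aV bV b'V dV => e; rewrite [RHS]mulgA -e -!mulgA.
by rewrite (braidA (braid_sym ab)) (involK aV) (involK bV).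
Qed.

(** Conjugation by [a ^ b'] carries [d], [a] and [(a ^ b) ^ b'] to [c'], [b'] and [b ^ b'], and [d]
    commutes with the other two. *)
Lemma rel4_commute_inner a b b' c c' d :
  a^-1 = a -> b^-1 = b -> b'^-1 = b' -> c'^-1 = c' -> d^-1 = d ->
  rel4 a a b b' c c' d d -> commute a d -> commute c' b /\ commute c' b'.
Proof.
move=> aV bV b'V c'V dV r ad; have e := rel4_conj aV bV b'V dV r.
case: r => -[[_ _ _] [_ /gtripleP/braid_sym dc' _] /gcommP bad _].
move=> [[[/gtripleP ab /gtripleP ab' _] _ _ _] _].
rewrite -(braid_conj dV dc') in e.
have ec' : c' = d ^ (a ^ b') by rewrite e braid_conj2.
have eb' : b' = a ^ (a ^ b') by rewrite braid_conj2.
have c'b' : commute c' b' by rewrite eb' ec'; apply/commuteJ.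
split=> //.
have eb : b ^ b' = ((a ^ b) ^ b') ^ (a ^ b').
  by rewrite -conjJg (braid_conj aV ab) conjg_invol.
apply/(commuteJ _ _ b'); rewrite (commuteJE c'b') eb ec'; apply/commuteJ.
by apply: commute_sym; move: bad; rewrite /conjg bV b'V !mulgA.
Qed.

(** Since [u * a' = a * u], the given relation for [c'] is this formula conjugated by [a], which
    commutes with [c] and [c']. *)
Lemma rel3_second a a' b b' c c' : rel3 a a' b b' c c' ->
  let u := b' * b in c' = c * u * c * u^-1 * c^-1.
Proof.
case=> _ ea _ ec' [/gcommP ac /gcommP ac' _ _] u.
have ua' : u * a' = a * u by rewrite ea /u !mulgA !mulgVK.
have {}ec' : c' = c * (u * a' * u * (u * a')^-1) * c
    * (u * a' * (u * a' * u)^-1) * c^-1.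
  by rewrite {1}ec' /u !invgM !mulgA.
have {}ec' : c' = (c * a) * u * a^-1 * (c * a) * u^-1 * (c * a)^-1.
  by rewrite {1}ec' ua' !invgM !mulgA !mulgK.
rewrite -(commuteJE (commute_sym ac')) ec' -ac /conjg !invgM.
by rewrite -!mulgA !mulKg mulVg mulg1.
Qed.

(** Conjugation by [a] fixes [c] and removes [a'] from the braid relations; what remains is the
    dihedral configuration of [commute_translation] with [t = b']. *)
Lemma rel3_braid a a' b b' c c' :
  b^-1 = b -> b'^-1 = b' -> rel3 a a' b b' c c' ->
  let u := b' * b in
  [/\ braid c b', braid c (u * b') & braid c (u * u * b')].
Proof.
move=> bV b'V [_ ea [/gtripleP cb /gtripleP cb' /gtripleP cbb'] _].
case=> /gcommP ac _ _ _ u.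
have ua' : u * a' = a * u by rewrite ea /u !mulgA !mulgVK.
have red x : braid c (b' * b * a' * x * a'^-1 * b^-1 * b'^-1) ->
    braid c (u * x * u^-1).
  move=> h; apply/(braidJ _ _ a^-1).
  rewrite (commuteJE (commuteV (commute_sym ac))).
  have -> : (u * x * u^-1) ^ a^-1 = u * a' * x * (u * a')^-1.
    by rewrite ua' /conjg invgK !invgM !mulgA.
  by rewrite !invgM !mulgA.
have b'b := involK b'V; have bb := involK bV.
split.
- move: (red (b^-1 * b' * b)); rewrite !mulgA => /(_ cbb').
  by rewrite /u invgM b'V bV -!mulgA !bb b'b.
- by move: (red b cb); rewrite /u invgM b'V bV -!mulgA bb.
- by move: (red b' cb'); rewrite /u invgM b'V bV -!mulgA.
Qed.

Lemma rel3_commute_conj a a' b b' c c' :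
  b^-1 = b -> b'^-1 = b' -> c^-1 = c -> rel3 a a' b b' c c' ->
  commute ((b' * b) ^ c) (b' * b).
Proof.
move=> bV b'V cV r; have [cb' cub' cuub'] := rel3_braid bV b'V r.
apply: (@commute_translation c b') => //.
by rewrite /conjg invgM b'V bV -!mulgA (involK b'V).
Qed.

(* Here t := y' y commutes with u, and conjugating t w u = u t w by y yields
   w ^ y = t w and then t w = w t; as y' = t y fixes w, t is trivial. *)
Lemma eq_of_commute_product y y' u w : y^-1 = y ->
  y' = y * u * y * u^-1 * y^-1 ->
  commute (u ^ y) u -> commute u w -> commute y' w ->
  commute y (y' * y * w * u) -> y' = y.
Proof.
move=> yV ey' Nu uw y'w; set t := y' * y => ytwu.
have y'E : y' = t * y by rewrite /t -mulgA invol_mul ?mulg1.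
have Nt : u ^ y = t * u by rewrite /t ey' /conjg !mulgA !mulgVK yV.
have tu : commute u t.
  have -> : t = u ^ y * u^-1 by rewrite Nt mulgK.
  by apply: commuteM; [exact/commute_sym|exact/commuteV/commute_refl].
have ty : t ^ y = t^-1.
  have y'V : y'^-1 = y' by rewrite ey' !invgM !invgK yV !mulgA.
  by rewrite /t /conjg invgM y'V -mulgA (invol_mul yV) mulg1.
have wy : w ^ y = t * w.
  move: (commuteJE (commute_sym ytwu)); rewrite -(commuteM tu uw).
  by rewrite conjMg (conjMg t) Nt ty -tu -mulgA mulKVg => /mulgI.
have tw : commute t w.
  move: (commuteJE (commute_sym ytwu)).
  by rewrite conjMg conjMg ty Nt wy mulKg mulgA => /mulIg.
have : w ^ y' = w by apply: commuteJE; exact: commute_sym.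
rewrite y'E conjgM (commuteJE (commute_sym tw)) wy -{2}[w]mul1g => /mulIg ->.
by rewrite mul1g.
Qed.

(** With [c' = c], [rel3_second] makes [u = b' * b] commute with [c]; then [u * b'] and [b'], both
    braided with [c], conjugate it alike, so [u = 1]. *)
Lemma rel3_collapse a a' b b' c :
  b^-1 = b -> b'^-1 = b' -> c^-1 = c -> rel3 a a' b b' c c ->
  b' = b /\ a' = a.
Proof.
move=> bV b'V cV r.
have [cb' cub' _] := rel3_braid bV b'V r.
have cu : commute c (b' * b).
  have /= := rel3_second r; move: (b' * b) => u.
  by rewrite -{1}[c]mulg1 -!mulgA => /mulgI/esym; rewrite !mulgA;
    move=> /gcommP/commute_sym.
have : b' * b * b' = b'.
  apply: (braid_inj (braid_sym cub') (braid_sym cb')).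
  by rewrite !invgM bV b'V mulgA conjgM (commuteJE cu).
rewrite -[RHS]mul1g => /mulIg /(congr1 (mulg b')); rewrite (involK b'V) mulg1.
move=> eb; split=> //; case: r => _ -> _ _ _.
by rewrite eb b'V (invol_mul b'V) mul1g -mulgA (invol_mul b'V) mulg1.
Qed.

Lemma rel4_inner_eq a b b' c d : rel4 a a b b' c c d d -> b' = b.
Proof.
case=> _ [_ [e1 e2 _ _]]; move: e2; rewrite mulgK -e1.
by move=> /mulIg/mulIg/mulIg/mulgI.
Qed.

(** Once the pairs at a vertex coincide, this eliminates the generator [b]; its conjugation formula
    transports the given braid relations to the other adjacent edges. *)
Lemma rel4_doubled a b c d :
  a^-1 = a -> b^-1 = b -> c^-1 = c -> d^-1 = d ->
  rel4 a a b b c c d d -> commute a d ->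
  [/\ b = c ^ (d * a), braid a b, braid c d, braid a c & braid b d].
Proof.
move=> aV bV cV dV r ad; have e := rel4_conj aV bV bV dV r.
case: r => -[[/gtripleP ab _ _] [/gtripleP cd _ _] _ _] _.
have eb : b = c ^ (d * a).
  by rewrite conjgM -e (braid_conj aV ab) conjg_invol.
split=> //.
- apply/(braidJ _ _ d); apply/(braidJ _ _ a).
  by rewrite (commuteJE ad) [a ^ a]commuteJE// -conjgM -eb.
- apply/(braidJ _ _ a); apply/(braidJ _ _ d).
  rewrite (commuteJE (commute_sym ad)) [d ^ d]commuteJE// eb conjgM.
  by rewrite !conjg_invol.
Qed.

End BraidRelations.

(** * Transport of the relations along homomorphisms *)

Section Homomorphism.
Local Open Scope group_scope.
Context {G H : groupType} (f : {multiplicative G -> H}).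

Lemma hom1 : f 1 = 1.
Proof. by apply: (mulgI (f 1)); rewrite -gmulfM !mulg1. Qed.

Lemma homV x : f x^-1 = (f x)^-1.
Proof. by apply: (mulgI (f x)); rewrite -gmulfM !mulgV hom1. Qed.

Lemma hom_rel4 a a' b b' c c' d d' : rel4 a a' b b' c c' d d' ->
  rel4 (f a) (f a') (f b) (f b') (f c) (f c') (f d) (f d').
Proof.
have E x y : x = y -> f x = f y by move=> ->.
rewrite /rel4 /gtriple /gcomm.
case=> -[[/E e1 /E e2 /E e3] [/E e4 /E e5 /E e6] /E e7 /E e8].
case=> -[[/E f1 /E f2 /E f3] [/E f4 /E f5 /E f6] /E f7 /E f8].
case=> /E g1 /E g2 /E g3 /E g4; rewrite !(gmulfM, homV, hom1) in
  e1 e2 e3 e4 e5 e6 e7 e8 f1 f2 f3 f4 f5 f6 f7 f8 g1 g2 g3 g4.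
by [].
Qed.

Lemma hom_rel3 a a' b b' c c' : rel3 a a' b b' c c' ->
  rel3 (f a) (f a') (f b) (f b') (f c) (f c').
Proof.
have E x y : x = y -> f x = f y by move=> ->.
rewrite /rel3 /gtriple /gcomm.
case=> -[/E e1 /E e2 /E e3] /E e4 [/E e5 /E e6 /E e7] /E e8.
case=> /E f1 /E f2 /E f3 /E f4.
rewrite !(gmulfM, homV, hom1) in e1 e2 e3 e4 e5 e6 e7 e8 f1 f2 f3 f4.
by [].
Qed.

End Homomorphism.

(** * Coxeter normal form in type A *)

Section CoxeterNormalForm.
Local Open Scope group_scope.
Context {G : groupType} (s : nat -> G) (n : nat).
Hypothesis sV : forall i, (i < n)%N -> (s i)^-1 = s i.
Hypothesis s_braid : forall i, (i.+1 < n)%N -> braid (s i) (s i.+1).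
Hypothesis s_commute : forall i j, (i.+1 < j < n)%N -> commute (s i) (s j).

(** The descending words s_k s_(k-1) ... s_(k-d+1), for d at most k+1, play the role of coset
    representatives of S_(k+1) in S_(k+2). *)
Fixpoint run (k d : nat) : G :=
  if d is d'.+1 then run k d' * s (k - d') else 1.

Fixpoint normal_form (k : nat) (x : G) : Prop :=
  if k is k'.+1 then
    exists h d, [/\ normal_form k' h, (d <= k)%N & x = h * run k' d]
  else x = 1.

Lemma run_commute k d i : (i + d < k < n)%N -> commute (s i) (run k d).
Proof.
elim: d => [|d IH] /= /andP[idk kn]; first exact: commute1.
by apply: commuteM; [apply: IH|apply: s_commute]; lia.
Qed.

(** The letter [s i] moves left to the factor [s i * s i.-1] of the run, where the braid relation
    turns it into an [s i.-1] that commutes with the larger letters. *)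
Lemma run_shift k d i : (0 < i <= k)%N -> (k < i + d.-1)%N -> (d <= k.+1)%N ->
  (k < n)%N -> run k d * s i = s i.-1 * run k d.
Proof.
elim: d => [|d IH] /= ik kid dk kn; first by lia.
have [di|di] := ltnP k (i + d.-1).
  rewrite -mulgA (s_commute (i := k - d)) ?mulgA ?IH//; lia.
case: d {IH} => [|d] /= in kid dk di *; first by lia.
have <- : i = (k - d)%N by lia.
have -> : (k - d.+1)%N = i.-1 by lia.
case: i => [|i] in ik kid di *; first by lia.
have sb : braid (s i) (s i.+1) by apply: s_braid; lia.
have sr : commute (s i) (run k d) by apply: run_commute; lia.
by rewrite /= -!mulgA (mulgA (s i.+1)) -sb -!mulgA (mulgA (run k d)) -sr !mulgA.
Qed.

(** The new letter lengthens the last run, cancels its final letter, or crosses it as [s i] or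
    [s i.-1] and is absorbed by the shorter normal form. *)
Lemma normal_form_mulr k x i : (i < k <= n)%N -> normal_form k x ->
  normal_form k (x * s i).
Proof.
elim: k x i => [|k IH] x i //= ikn [h [d [hh dk ->]]].
have [e|] := eqVneq (i + d)%N k.
  exists h, d.+1; split=> //=; first lia.
  by rewrite -mulgA; congr (_ * (_ * s _)); lia.
have [e _|ne1 ne2] := eqVneq (i + d)%N k.+1.
  case: d => [|d] in dk e *; first by lia.
  exists h, d; split=> //=; first lia.
  have -> : (k - d)%N = i by lia.
  by rewrite -!mulgA invol_mul ?mulg1// sV//; lia.
have [lt|gt] := ltnP (i + d) k.
  exists (h * s i), d; split=> //=; first by apply: IH => //; lia.
  by rewrite -!mulgA run_commute//; lia.
exists (h * s i.-1), d; split=> //; first by apply: IH => //; lia.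
by rewrite -!mulgA run_shift//; lia.
Qed.

Lemma normal_form_mulr_iff k x i : (i < k <= n)%N ->
  normal_form k (x * s i) <-> normal_form k x.
Proof.
move=> ikn; split=> [/(normal_form_mulr ikn)|]; last exact: normal_form_mulr.
by rewrite -mulgA invol_mul ?mulg1// sV//; lia.
Qed.

Context {T : finType} (p : nat -> T) (psi : {multiplicative G -> {perm T}}).
Hypothesis p_inj : forall i j, (i <= n)%N -> (j <= n)%N -> p i = p j -> i = j.
Hypothesis psi_s : forall i, (i < n)%N -> psi (s i) = tperm (p i) (p i.+1).

Lemma psi_run k d : (d <= k.+1)%N -> (k < n)%N ->
  psi (run k d) (p k.+1) = p (k.+1 - d).
Proof.
elim: d => [|d IH] /= dk kn; first by rewrite hom1 perm1.
rewrite gmulfM permM IH//; last by lia.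
rewrite psi_s; last by lia.
by rewrite subSn ?tpermR; [congr p|]; lia.
Qed.

Lemma psi_run_fix k d m : (d <= k.+1)%N -> (k.+1 < m <= n)%N ->
  psi (run k d) (p m) = p m.
Proof.
elim: d => [|d IH] /= dk kn; first by rewrite hom1 perm1.
rewrite gmulfM permM IH//; last by lia.
rewrite psi_s; last by lia.
by rewrite tpermD//; apply/eqP => /p_inj; lia.
Qed.

Lemma psi_normal_form_fix k x m : normal_form k x -> (k < m <= n)%N ->
  psi x (p m) = p m.
Proof.
elim: k x => [|k IH] x /=; first by move=> ->; rewrite hom1 perm1.
move=> [h [d [hh dk ->]]] km; rewrite gmulfM permM IH//; last by lia.
by rewrite psi_run_fix.
Qed.

(** The factor [h] acts first and fixes [p k.+1], so the image of this point reveals the length [d]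
    of the last run. *)
Lemma psi_normal_form_inj k x : (k <= n)%N -> normal_form k x ->
  psi x = 1 -> x = 1.
Proof.
elim: k x => [//|k IH] x kn /= [h [d [hh dk ->]]] px.
have : psi (h * run k d) (p k.+1) = p k.+1 by rewrite px perm1.
rewrite gmulfM permM (psi_normal_form_fix hh); last by lia.
rewrite psi_run// => /p_inj d0; have {}d0 : d = 0%N by lia.
by move: px; rewrite d0 /= mulg1; apply: IH => //; lia.
Qed.

End CoxeterNormalForm.

Lemma hom_relations (G H : groupType) (f : {multiplicative G -> H})
  (g : nat -> bool -> G) : relations g -> relations (fun i b => f (g i b)).
Proof.
move=> [[r1 r2 r3] [r4 r5] [e1 e10] r6 r7]; split.
- by split; exact: hom_rel4.
- by split; exact: hom_rel3.
- by rewrite e1 e10.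
- move=> i j x y i10 j10 ij; have := congr1 f (r6 i j x y i10 j10 ij).
  by rewrite /gcomm !gmulfM !homV hom1.
- by have := congr1 f r7; rewrite !big_cons !big_nil !gmulfM hom1.
Qed.

(** * Involutions satisfying all the relations of the presentation *)

Section Relations.
Local Open Scope group_scope.
Context {G : groupType} (g : nat -> bool -> G).
Hypothesis gV : forall i b, (0 < i <= 10)%N -> (g i b)^-1 = g i b.
Hypothesis g_relations : relations g.

Lemma relations_doubled i : (0 < i <= 10)%N -> g i true = g i false.
Proof.
case: g_relations => [[r1 r2 r3] [r4 r5] [e1 e10] r6 r7].
have e4 : g 4 true = g 4 false.
  by move: r1; rewrite -e1; exact: rel4_right_eq.
have e7 : g 7 true = g 7 false.
  by move: r3; rewrite -e10; exact: rel4_left_eq.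
rewrite e4 e7 in r2; rewrite -e10 e7 in r3.
have com m n x y : (0 < m <= 10)%N -> (0 < n <= 10)%N ->
    ~~ has (mem (edge m)) (edge n) -> commute (g m x) (g n y).
  by move=> m10 n10 mn; apply/gcommP; exact: r6.
have comM m n x : (0 < m <= 10)%N -> (0 < n <= 10)%N ->
    ~~ has (mem (edge m)) (edge n) -> commute (g m x) (g n true * g n false).
  by move=> m10 n10 mn; apply: commuteM; exact: com.
have {r7} rp : (g 9 true * g 9 false) * (g 8 true * g 8 false)
    * (g 6 true * g 6 false) * ((g 5 true * g 5 false)
    * ((g 3 true * g 3 false) * (g 2 true * g 2 false))) = 1.
  move: r7; rewrite !big_cons big_nil -e1 -e10 e4 e7.
  by rewrite !(invol_mul (gV _ _))// !mul1g !mulg1 !mulgA.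
(* By the projective relation, the [u] of this vertex is inverse to a product over the edges 6, 5,
   3, 2, all disjoint from edge 10. *)
have c7_10 : commute (g 7 false) (g 10 false).
  apply: (rel4_commute_outer r3); right.
  move: rp => /(canRL (mulgK _)); rewrite mul1g => /(canRL (mulgK _)) ->.
  rewrite -invgM; apply: commuteV.
  by apply: commuteM; [|apply: commuteM; [|apply: commuteM]]; apply: comM.
have [c98 c98'] :
    commute (g 9 true) (g 8 false) /\ commute (g 9 true) (g 8 true).
  by apply: (rel4_commute_inner _ _ _ _ _ r3); rewrite ?gV.
have c93 b : commute (g 9 false) (g 3 b).
  by case: r5 => _ _ _ _ [/gcommP h _ /gcommP h' _]; apply/commute_sym; case: b.
have e9 : g 9 true = g 9 false.
  apply: (@eq_of_commute_product _ _ _ (g 6 true * g 6 false)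
    (g 8 true * g 8 false)).
  - exact: gV.
  - exact: rel3_second r5.
  - by apply: rel3_commute_conj r5; exact: gV.
  - by apply: commuteM; apply/commute_sym; exact: comM.
  - exact: commuteM.
  (* The product is inverse to one over the edges 5, 3, 2: edges 5 and 2 are disjoint from 9, and
     edge 3 commutes with 9 by the relations at V_5. *)
  - move: rp => /(canRL (mulgK _)) ->; rewrite mul1g; apply: commuteV.
    apply: commuteM; first exact: comM.
    by apply: commuteM; [apply: commuteM|apply: comM].
(* The collapse spreads from V_5 through V_2 (edge 5) to V_4 (edges 8 and 2). *)
have [e6 e3] : g 6 true = g 6 false /\ g 3 true = g 3 false.
  by move: r5; rewrite e9; apply: rel3_collapse; exact: gV.
have e5 : g 5 true = g 5 false.
  by move: r2; rewrite e6; exact: rel4_inner_eq.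
have e8 : g 8 true = g 8 false.
  have /= -> := rel3_second r4.
  by rewrite e5 (invol_mul (gV (i := 5) false isT)) invg1 !mulg1 mulgK.
have [_ e2] : g 5 true = g 5 false /\ g 2 true = g 2 false.
  by move: r4; rewrite e8; apply: rel3_collapse; exact: gV.
by do 11?[case: i => [|i] //].
Qed.

(* The edges shared by consecutive triangles among [path_triangle] below. *)
Definition path_edge (i : nat) : nat := nth 0%N [:: 1; 3; 4; 5; 7; 9; 10]%N i.

Definition path_gen (i : nat) : G := g (path_edge i) false.

Lemma path_rel :
  [/\ forall i, (i < 7)%N -> (path_gen i)^-1 = path_gen i,
      forall i, (i.+1 < 7)%N -> braid (path_gen i) (path_gen i.+1),
      forall i j, (i.+1 < j < 7)%N -> commute (path_gen i) (path_gen j) &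
      [/\ g 2 false = path_gen 1 ^ (path_gen 2 * path_gen 0),
          g 6 false = path_gen 3 ^ (path_gen 2 * path_gen 4) &
          g 8 false = path_gen 5 ^ (path_gen 6 * path_gen 4)]].
Proof.
have dbl := relations_doubled.
case: g_relations => [[r1 r2 r3] [r4 r5] _ r6 _].
rewrite !dbl// in r1 r2 r3 r4 r5.
have out (a b c d : G) : b^-1 = b -> c^-1 = c ->
    rel4 a a b b c c d d -> commute a d.
  move=> bV cV r; apply: (rel4_commute_outer r); left.
  by rewrite (invol_mul bV) (invol_mul cV) mulg1; exact: commute1.
have c14 : commute (g 1 false) (g 4 false) by apply: out r1; exact: gV.
have c47 : commute (g 4 false) (g 7 false) by apply: out r2; exact: gV.
have c710 : commute (g 7 false) (g 10 false) by apply: out r3; exact: gV.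
have gF i : (0 < i <= 10)%N -> (g i false)^-1 = g i false by exact: gV.
have [e2 _ b34 b13 _] :=
  rel4_doubled (gF 1%N isT) (gF 2%N isT) (gF 3%N isT) (gF 4%N isT) r1 c14.
have [e5 b45 _ _ b57] :=
  rel4_doubled (gF 4%N isT) (gF 5%N isT) (gF 6%N isT) (gF 7%N isT) r2 c47.
have [e8 _ b910 b79 _] :=
  rel4_doubled (gF 7%N isT) (gF 8%N isT) (gF 9%N isT) (gF 10%N isT) r3 c710.
have c39 : commute (g 3 false) (g 9 false).
  by case: r5 => _ _ _ _ [/gcommP].
have com i j : (0 < path_edge i <= 10)%N -> (0 < path_edge j <= 10)%N ->
    ~~ has (mem (edge (path_edge i))) (edge (path_edge j)) ->
    commute (path_gen i) (path_gen j).
  by move=> i10 j10 ij; apply/gcommP; exact: r6.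
split.
- by case=> [|[|[|[|[|[|[|i]]]]]]] // _; exact: gV.
- by case=> [_|[_|[_|[_|[_|[_|i]]]]]].
(* Among non-consecutive edges of the path only the pairs 1-4, 3-9, 4-7 and 7-10 share a vertex. *)
- move=> i j /andP[].
  case: j => [|[|[|[|[|[|[|j]]]]]]] //; case: i => [|[|[|[|[|i]]]]] // _ _;
    by first [exact: com|exact: c14|exact: c39|exact: c47|exact: c710].
- split; [exact: e2| |exact: e8].
  (* [rel4_doubled] expresses edge 5 through edge 6; the conjugation is undone because 4 and 7 are
     involutions. *)
  rewrite [path_gen 3]e5 /path_gen /= !conjgM.
  by rewrite !conjg_invol// gV.
Qed.

End Relations.

Lemma nproj_invol (G : groupType) (g : nat -> bool -> G) i b :
  (0 < i <= 10)%N ->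
  ((nproj (squares g) (g i b))^-1 = nproj (squares g) (g i b))%g.
Proof.
move=> i10; have e : (nproj (squares g) (g i b ^+ 2) = 1)%g.
  rewrite -(hom1 (nproj (squares g))); apply/nprojP => K [[[_ _ KV] _]] AK.
  by rewrite mulg1; apply: KV; apply: AK; exists i, b.
by apply: (mulgI (nproj (squares g) (g i b))); rewrite mulgV -gmulfM -e.
Qed.

Definition path_triangle (i : nat) : 'I_8 :=
  nth ord0 [:: @Ordinal 8 0 isT; @Ordinal 8 3 isT; @Ordinal 8 2 isT;
    @Ordinal 8 1 isT; @Ordinal 8 4 isT; @Ordinal 8 7 isT; @Ordinal 8 6 isT;
    @Ordinal 8 5 isT] i.

Lemma path_triangle_inj i j : (i <= 7)%N -> (j <= 7)%N ->
  path_triangle i = path_triangle j -> i = j.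
Proof. by move=> i7 j7 /eqP; rewrite nth_uniq// => /eqP. Qed.

(** * Injectivity of the map to S_8 *)

Section GaloisSequence.
Context {Pi G : groupType} (g : nat -> bool -> G).
Context (iota : {multiplicative Pi -> nquot (squares g)}).
Context (psi : {multiplicative nquot (squares g) -> 'S_8}).
Hypothesis g_presented : presented g.
Hypothesis exact_seq : galois_sequence iota psi.
Local Notation q := (fun i b => nproj (squares g) (g i b)).

Let q_relations : relations q .
Proof. by case: g_presented => + _ _; exact: hom_relations. Qed.
Let qV := @nproj_invol G g.

Lemma nquot_normal_form (x : nquot (squares g)) :
  normal_form (path_gen q) 7 x.
Proof.
have [sV sb sc [e2 e6 e8]] := path_rel qV q_relations.
pose NF := normal_form (path_gen q) 7.
(* Asking for an equivalence makes [K] closed under inverses, hence a subgroup; it contains the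
   generators, and [h = 1] then gives the claim. *)
pose K := [set x : nquot (squares g) | forall h, NF (h * x)%g <-> NF h].
have KM y z : K y -> K z -> K (y * z)%g by move=> Ky Kz h; rewrite mulgA Kz.
have KV y : K y -> K (y^-1)%g by move=> Ky h; rewrite -Ky mulgVK.
have Ks i : (i < 7)%N -> K (path_gen q i).
  by move=> i7 h; apply: (normal_form_mulr_iff sV sb sc); rewrite i7.
have KJ i j k : (i < 7)%N -> (j < 7)%N -> (k < 7)%N ->
    K (path_gen q i ^ (path_gen q j * path_gen q k))%g.
  move=> i7 j7 k7; have Kjk := KM _ _ (Ks _ j7) (Ks _ k7).
  exact: KM (KV _ Kjk) (KM _ _ (Ks _ i7) Kjk).
have Kq i : (0 < i <= 10)%N -> K (q i false).
  do 11?[case: i => [|i] //] => _;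
    by first [exact: (Ks 0%N isT)|exact: (Ks 1%N isT)|exact: (Ks 2%N isT)|
      exact: (Ks 3%N isT)|exact: (Ks 4%N isT)|exact: (Ks 5%N isT)|
      exact: (Ks 6%N isT)|rewrite e2; exact: KJ|rewrite e6; exact: KJ|
      rewrite e8; exact: KJ].
have KT : (nproj (squares g)) @^-1` K = setT.
  have [_ gen _] := g_presented; apply: gen; first split.
  - by move=> h; rewrite hom1 mulg1.
  - by move=> y z Ky Kz; rewrite /preimage/= gmulfM; exact: KM.
  - by move=> y Ky; rewrite /preimage/= homV; exact: KV.
  move=> i [] i10; rewrite /preimage/=; last exact: Kq.
  by rewrite (relations_doubled qV q_relations i10); exact: Kq.
have : ((nproj (squares g)) @^-1` K) (generic_quotient.repr x) by rewrite KT.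
rewrite /preimage/= /nproj generic_quotient.reprK => /(_ 1%g)[_].
rewrite mul1g; apply.
(* The identity is the normal form in which every run is empty. *)
by do 7!(exists 1%g, 0%N; split; rewrite ?mulg1//).
Qed.

Lemma galois_sequence_trivial (a : Pi) : a = 1%g.
Proof.
have [iota_inj psi_iota _ psi_q] := exact_seq.
have [sV sb sc _] := path_rel qV q_relations.
have psi_s i : (i < 7)%N ->
    psi (path_gen q i) = tperm (path_triangle i) (path_triangle i.+1).
  by case: i => [|[|[|[|[|[|[|i]]]]]]] // _; apply: psi_q => //; apply/allP.
apply: iota_inj; rewrite hom1.
apply: (psi_normal_form_inj path_triangle_inj psi_s (leqnn 7)).
  exact: nquot_normal_form.
by apply/psi_iota; exists a.
Qed.

End GaloisSequence.

Theorem theorem3p2 (R : realType) (N : nat) (X : set (CP R N))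
    (Xsurface : projective_surface X) (Xdegree : surface_degree X 8)
    (Xdegeneration : degenerates_to_planes X triangle)
    (L : 'M[Cplx R]_(N.+1, 3)) (Lgeneric : generic_projection L X)
    (x0 : galois_cover 8 L X) (y0 : ~` branch_curve L X)
    (gamma : nat -> bool -> pi1 R y0) (Ggamma : presented gamma)
    (iota : {multiplicative pi1 R x0 -> nquot (squares gamma)})
    (psi : {multiplicative nquot (squares gamma) -> 'S_8})
    (exact_seq : galois_sequence iota psi) :
  forall a : pi1 R x0, a = 1%g.
Proof.
exact: (galois_sequence_trivial Ggamma exact_seq).
Qed.
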